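(* (a) Let $L$ and $M$ be preordered groups, $M$ complete, $K$ a subgroup of $L$ and $\varphi: K\longrightarrow M$ an isotonic group homomorphism. Then $\varphi^*:\overline{K}\longrightarrow M$ is an isotonic group homomorphism (in particular, $\overline K$ is a subgroup of $L$). (b) Let $L$ and $M$ be preordered real vector spaces, $M$ complete, $K$ a linear subspace of $L$ and $\varphi: K\longrightarrow M$ isotonic and linear. Then $\varphi^*:\overline{K}\longrightarrow M$ is isotonic and linear (in particular, $\overline K$ is a linear subspace of $L$).
   Context: A preorder on a set is a reflexive and transitive binary relation (not necessarily antisymmetric). A mapping between preordered sets is isotonic if it preserves the order: $x\le y$ implies that the image of $x$ is $\le$ the image of $y$. A preordered set $(M,\le)$ is complete if every nonempty subset which is bounded from below has a unique infimum (greatest lower bound) and every nonempty subset which is bounded from above has a unique supremum (least upper bound); it follows that $\le$ is antisymmetric on $M$. A preordered group is a group $(G,+)$ (written additively, not assumed to be commutative) with a preorder $\le$ such that for all $a,b,c,d\in G$: $a\le b$ and $c\le d$ imply $a+c\le b+d$. A preordered real vector space is a real vector space $V$ with a preorder $\le$ such that $(V,+,\le)$ is a preordered group and, for all $a,b\in V$ and $\lambda\in\mathbb{R}^+$ (that is, $\lambda>0$), $a\le b$ implies $\lambda a\le\lambda b$. Let $L$, $M$ be preordered sets, $M$ complete, $K\subseteq L$ and $\varphi:K\longrightarrow M$ isotonic ($K$ with the preorder of $L$). An element $f\in L$ is $K$-bounded if there are $a,b\in K$ with $a\le f\le b$. For $K$-bounded $f\in L$ let \[\varphi_*(f):=\sup\{\varphi(a)\mid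 a\in K,\ a\le f\},\qquad \varphi^*(f):=\inf\{\varphi(b)\mid b\in K,\ f\le b\}.\] The $\varphi$-closure of $K$ in $L$ is the set $\overline K$ of all $K$-bounded $f\in L$ with $\varphi_*(f)=\varphi^*(f)$. The map $\varphi^*:\overline K\longrightarrow M$ is $f\longmapsto\varphi^*(f)$. *)

(* Defs.v *)
From mathcomp Require Import all_boot all_order all_algebra.
From mathcomp Require Import boolp classical_sets reals.
From Stdlib Require Import Relation_Definitions RelationClasses.

Set Implicit Arguments.
Unset Strict Implicit.
Unset Printing Implicit Defensive.

Import Order.TTheory GRing.Theory Num.Theory.

Local Open Scope classical_set_scope.

(* Preorders are Prop-valued relations rather than [preorderType] structures:
   [preorderType] cannot be joined with [lmodType], and [ubound], [supremums],
   etc. of [classical_sets] require an antisymmetric order. *)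
Section Bounds.
Context {T : Type} (le : relation T).
Implicit Types A : set T.

Definition upper_bounds A : set T := [set y | forall x, A x -> le x y].
Definition lower_bounds A : set T := [set y | forall x, A x -> le y x].
Definition suprema A : set T := upper_bounds A `&` lower_bounds (upper_bounds A).
Definition infima A : set T := lower_bounds A `&` upper_bounds (lower_bounds A).

Definition order_complete : Prop :=
  (forall A : set T, A !=set0 -> lower_bounds A !=set0 ->
     exists! m, infima A m) /\
  (forall A : set T, A !=set0 -> upper_bounds A !=set0 ->
     exists! m, suprema A m).

End Bounds.

(* The library's general groups are written multiplicatively: [groupType] plays
   the role of the additively written, possibly noncommutative groups. *)
Record preordered_group (G : groupType) (le : relation G) : Prop := {
  preordered_group_preorder :> PreOrder le;
  preordered_group_mul : forall a b c e : G,
    le a b -> le c e -> le (a * c)%g (b * e)%g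
}.

(* [to_multiplicative V] is the group (V, +). *)
Record preordered_vector_space (R : realType) (V : lmodType R)
    (le : relation V) : Prop := {
  preordered_vector_space_group :>
    preordered_group (le : relation (Algebra.to_multiplicative V));
  preordered_vector_space_scale : forall (a b : V) (k : R),
    (0 < k)%R -> le a b -> le (k *: a)%R (k *: b)%R
}.

(* A map phi : K -> M is represented by a total function on L of which only
   the values on K matter. *)
Section Extension.
Context {L : Type} {M : choiceType} (leL : relation L) (leM : relation M).
Implicit Types (K : set L) (phi : L -> M) (f : L).

Definition isotonic_on K phi : Prop :=
  {in K &, {homo phi : x y / leL x y >-> leM x y}}.

Definition bounded_by K f : Prop :=
  exists a b, [/\ K a, K b, leL a f & leL f b].

(* The default value [phi f] of [xget] is irrelevant: when M is complete, phi is
   isotonic on K and f is K-bounded, the supremum and the infimum below exist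
   and are unique. *)
Definition lower_ext K phi f : M :=
  xget (phi f) (suprema leM [set phi a | a in [set a | K a /\ leL a f]]).

Definition upper_ext K phi f : M :=
  xget (phi f) (infima leM [set phi b | b in [set b | K b /\ leL f b]]).

Definition ext_closure K phi : set L :=
  [set f | bounded_by K f /\ lower_ext K phi f = upper_ext K phi f].

End Extension.

Definition group_hom_on (L M : groupType) (K : set L) (phi : L -> M) : Prop :=
  {in K &, {morph phi : x y / (x * y)%g}}.

Definition linear_on (R : realType) (L M : lmodType R) (K : set L)
    (phi : L -> M) : Prop :=
  forall k : R, {in K &, {morph phi : x y / (k *: x + y)%R}}.

(* Main.v *)
(* Call v the value at f if v is both the supremum of phi over the elements of K
   below f and the infimum of phi over those above f; the closure consists of
   the K-bounded f having a value, which is then phi^*(f).  In a preordered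
   group suprema and infima are compatible with products of sets: if z <= a b
   for all a in A and b in B, then a^-1 z <= inf B, hence z <= inf A * inf B.
   So values multiply: everything in K below f g is below all b c with f <= b
   and g <= c in K, which gives the upper bound inf * inf, and dually.
   Inversion and dilations by nonzero scalars are (anti-)automorphisms of the
   whole situation, so they transport values. *)

Require Import Defs.
From mathcomp Require Import all_boot all_order all_algebra.
From mathcomp Require Import boolp classical_sets reals.
From Stdlib Require Import Relation_Definitions RelationClasses Basics.

Set Implicit Arguments.
Unset Strict Implicit.
Unset Printing Implicit Defensive.

Import Order.TTheory GRing.Theory Num.Theory.
Local Open Scope classical_set_scope.

(** * Antisymmetry and uniqueness of bounds *)

Section Completeness.
Context {T : Type} {le : relation T}.
Hypotheses (le_pre : PreOrder le) (le_complete : order_complete le).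

(** If [x <= y <= x], both are suprema of the singleton of [x], and completeness allows only one. *)
Lemma order_complete_anti x y : le x y -> le y x -> x = y.
Proof.
move=> xy yx; have [_ sup_ex] := le_complete.
have [|| m [_ m_uniq]] := sup_ex [set x].
- by exists x.
- by exists x => _ ->; reflexivity.
have sup_x z : le x z -> le z x -> suprema le [set x] z.
  by move=> xz zx; split=> [_ -> //|u /(_ _ erefl) xu]; transitivity x.
have lexx : le x x by reflexivity.
by rewrite -(m_uniq x (sup_x x lexx lexx)) -(m_uniq y (sup_x y xy yx)).
Qed.

Lemma suprema_inj (A : set T) x y : suprema le A x -> suprema le A y -> x = y.
Proof. by move=> [xA Ax] [yA Ay]; apply: order_complete_anti; auto. Qed.

Lemma infima_inj (A : set T) x y : infima le A x -> infima le A y -> x = y.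
Proof. by move=> [xA Ax] [yA Ay]; apply: order_complete_anti; auto. Qed.

End Completeness.

(** * Values and order duality *)

Section Value.
Context {L M : Type} (leL : relation L) (leM : relation M).
Implicit Types (K : set L) (phi : L -> M) (f : L) (v : M).

(** As relations, these avoid the default of [xget], and flipping both orders turns [sup_below] into
    [inf_above] by conversion; the dual halves for transport and products rest on this. *)
Definition sup_below K phi f v :=
  suprema leM [set phi a | a in [set a | K a /\ leL a f]] v.

Definition inf_above K phi f v :=
  infima leM [set phi b | b in [set b | K b /\ leL f b]] v.

Definition has_value K phi f v :=
  [/\ bounded_by leL K f, sup_below K phi f v & inf_above K phi f v].

End Value.

Lemma bounded_by_flip (L : Type) (leL : relation L) (K : set L) f :
  bounded_by leL K f -> bounded_by (flip leL) K f.
Proof. by move=> [a [b [Ka Kb af fb]]]; exists b, a. Qed.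

Lemma has_value_flip (L M : Type) (leL : relation L) (leM : relation M)
    (K : set L) (phi : L -> M) f v :
  has_value leL leM K phi f v -> has_value (flip leL) (flip leM) K phi f v.
Proof. by move=> [fK supf inff]; split=> //; exact: bounded_by_flip. Qed.

(** * Values and the closure *)

Section ClosureValue.
Context {L : Type} {M : choiceType} {leL : relation L} {leM : relation M}.
Context {K : set L} {phi : L -> M}.
Hypotheses (preL : PreOrder leL) (preM : PreOrder leM).
Hypotheses (complM : order_complete leM) (phi_iso : isotonic_on leL leM K phi).

Lemma phi_le a b : K a -> K b -> leL a b -> leM (phi a) (phi b).
Proof. by move=> Ka Kb; apply: phi_iso; rewrite inE. Qed.

(** Boundedness feeds completeness: [a] gives nonemptiness and [phi b] an upper bound, so [xget]
    returns a genuine supremum. *)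
Lemma sup_below_lower_ext f : bounded_by leL K f ->
  sup_below leL leM K phi f (lower_ext leL leM K phi f).
Proof.
move=> [a [b [Ka Kb af fb]]]; apply: xgetPex.
have [|| m []] := complM.2 [set phi a | a in [set a | K a /\ leL a f]].
- by exists (phi a), a.
- exists (phi b) => _ [c [Kc cf] <-]; apply: phi_le => //.
  by transitivity f.
- by exists m.
Qed.

Lemma inf_above_upper_ext f : bounded_by leL K f ->
  inf_above leL leM K phi f (upper_ext leL leM K phi f).
Proof.
move=> [a [b [Ka Kb af fb]]]; apply: xgetPex.
have [|| m []] := complM.1 [set phi b | b in [set b | K b /\ leL f b]].
- by exists (phi b), b.
- exists (phi a) => _ [c [Kc cf] <-]; apply: phi_le => //.
  by transitivity f.
- by exists m.
Qed.

Lemma has_value_upper_ext f : ext_closure leL leM K phi f ->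
  has_value leL leM K phi f (upper_ext leL leM K phi f).
Proof.
move=> [fK lu]; split=> //; last exact: inf_above_upper_ext.
by rewrite -lu; exact: sup_below_lower_ext.
Qed.

(** With [has_value_upper_ext], this reduces membership in the closure and the computation of
    [upper_ext] to exhibiting a value. *)
Lemma has_value_closure f v : has_value leL leM K phi f v ->
  ext_closure leL leM K phi f /\ upper_ext leL leM K phi f = v.
Proof.
move=> [fK supf inff].
have lE := suprema_inj preM complM (sup_below_lower_ext fK) supf.
have uE := infima_inj preM complM (inf_above_upper_ext fK) inff.
by do 2?split; rewrite ?lE ?uE.
Qed.

Lemma has_value_id a : K a -> has_value leL leM K phi a (phi a).
Proof.
move=> Ka; have aa : leL a a by reflexivity.
split; first by exists a, a.
- split=> [_ [c [Kc ca] <-]|u ubu]; first exact: phi_le.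
  by apply: ubu; exists a.
- split=> [_ [c [Kc ca] <-]|u lbu]; first exact: phi_le.
  by apply: lbu; exists a.
Qed.

(** Elements of [K] above [g] are above [f], so the infimum at [f] is a lower bound of the set whose
    infimum is taken at [g]. *)
Lemma upper_ext_isotonic :
  isotonic_on leL leM (ext_closure leL leM K phi) (upper_ext leL leM K phi).
Proof.
move=> f g; rewrite !inE => /has_value_upper_ext [_ _ [lbf _]].
move=> /has_value_upper_ext [_ _ [_ inf_g]] fg; apply: inf_g.
move=> _ [b [Kb gb] <-]; apply: lbf; exists b => //; split=> //.
by transitivity g.
Qed.

End ClosureValue.

(** * Transport of values along order isomorphisms *)

Section Transport.
Context {L M : Type} {leL leL' : relation L} {leM leM' : relation M}.
Context {K : set L} {phi : L -> M} {s s' : L -> L} {t t' : M -> M}.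
Hypotheses (sK : cancel s s') (s'K : cancel s' s).
Hypotheses (tK : cancel t t') (t'K : cancel t' t).
Hypotheses (s_homo : {homo s : x y / leL x y >-> leL' x y})
  (s'_homo : {homo s' : x y / leL' x y >-> leL x y}).
Hypotheses (t_homo : {homo t : x y / leM x y >-> leM' x y})
  (t'_homo : {homo t' : x y / leM' x y >-> leM x y}).
Hypotheses (K_s : forall x, K x -> K (s x)) (K_s' : forall x, K x -> K (s' x)).
Hypothesis phi_s : forall x, K x -> phi (s x) = t (phi x).

(** Upper bounds are pulled back along [t']. Source and target orders are separate, so that
    order-reversing bijections are covered by flipping one side. *)
Lemma sup_below_transport f v :
  sup_below leL leM K phi f v -> sup_below leL' leM' K phi (s f) (t v).
Proof.
move=> [ubv leastv]; split=> [_ [a [Ka asf] <-]|u ubu].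
  rewrite -(s'K a) phi_s; last exact: K_s'.
  apply/t_homo/ubv; exists (s' a) => //; split; first exact: K_s'.
  by rewrite -(sK f); exact: s'_homo.
rewrite -(t'K u); apply/t_homo/leastv => _ [a [Ka af] <-].
rewrite -(tK (phi a)) -phi_s //; apply/t'_homo/ubu.
by exists (s a) => //; split; [exact: K_s|exact: s_homo].
Qed.

End Transport.

Lemma has_value_transport (L M : Type) (leL leL' : relation L)
    (leM leM' : relation M) (K : set L) (phi : L -> M)
    (s s' : L -> L) (t t' : M -> M) f v :
  cancel s s' -> cancel s' s -> cancel t t' -> cancel t' t ->
  {homo s : x y / leL x y >-> leL' x y} ->
  {homo s' : x y / leL' x y >-> leL x y} ->
  {homo t : x y / leM x y >-> leM' x y} ->
  {homo t' : x y / leM' x y >-> leM x y} ->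
  (forall x, K x -> K (s x)) -> (forall x, K x -> K (s' x)) ->
  (forall x, K x -> phi (s x) = t (phi x)) ->
  has_value leL leM K phi f v -> has_value leL' leM' K phi (s f) (t v).
Proof.
move=> sK s'K tK t'K hs hs' ht ht' Ks Ks' phis.
move=> [[a [b [Ka Kb af fb]]] supf inff]; split.
- by exists (s a), (s b); split; auto.
- exact: (sup_below_transport sK s'K tK t'K hs hs' ht ht' Ks Ks' phis).
(* The infimum half is the supremum half for the flipped orders. *)
- apply: (@sup_below_transport _ _ (flip leL) (flip leL') (flip leM) (flip leM')
    _ _ _ _ _ _ sK s'K tK t'K) => // x y; first exact: hs.
  + exact: hs'.
  + exact: ht.
  + exact: ht'.
Qed.

(** * Products of infima in a preordered group *)

Lemma preordered_group_flip (G : groupType) (le : relation G) :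
  preordered_group le -> preordered_group (flip le).
Proof.
move=> leG; split; last first.
  by move=> a b c e ab ce; exact: (preordered_group_mul leG ab ce).
by have := preordered_group_preorder leG; exact: flip_PreOrder.
Qed.

Section PreorderedGroup.
Context {G : groupType} {le : relation G} (leG : preordered_group le).
Local Open Scope group_scope.

Let le_refl x : le x x.
Proof. by have := preordered_group_preorder leG => ?; reflexivity. Qed.

Lemma le_mull x y z : le x y -> le (z * x) (z * y).
Proof. exact: preordered_group_mul. Qed.

Lemma le_mulr x y z : le x y -> le (x * z) (y * z).
Proof. by move=> xy; exact: preordered_group_mul. Qed.

Lemma le_invg x y : le x y -> le y^-1 x^-1.
Proof. by move=> /(le_mull x^-1) /(le_mulr y^-1); rewrite mulVg mul1g mulgK. Qed.

(** For fixed [b], [z * b^-1] is a lower bound of [A], so [z <= x * b]; thus [x^-1 * z] is a lower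
    bound of [B]. Dividing by [b] on the right and by [x] on the left avoids commutativity. *)
Lemma le_infM (A B : set G) x y z : infima le A x -> infima le B y ->
  (forall a b, A a -> B b -> le z (a * b)) -> le z (x * y).
Proof.
move=> [_ infA] [_ infB] zAB.
rewrite -(mulVKg x z); apply/le_mull/infB => b Bb.
rewrite -(mulKg x b); apply/le_mull; rewrite -(mulgVK b z).
by apply/le_mulr/infA => a Aa; rewrite -(mulgK b a); exact/le_mulr/zAB.
Qed.

End PreorderedGroup.

(** * Values of products and inverses *)

Section GroupValue.
Context {L M : groupType} {K : set L} {phi : L -> M}.
Hypotheses (Kgrp : group_closed [in K]) (phi_hom : group_hom_on K phi).
Local Open Scope group_scope.

Lemma group_closed_set1 : K 1.
Proof. by have [] := Kgrp; rewrite inE. Qed.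

Lemma group_closed_setV x : K x -> K x^-1.
Proof. by move=> Kx; rewrite -[K _]in_setE; apply: (group_closedV Kgrp); rewrite inE. Qed.

Lemma group_closed_setM x y : K x -> K y -> K (x * y).
Proof. by move=> Kx Ky; rewrite -[K _]in_setE; apply: (group_closedM Kgrp); rewrite inE. Qed.

Lemma hom_onM x y : K x -> K y -> phi (x * y) = phi x * phi y.
Proof. by move=> Kx Ky; apply: phi_hom; rewrite inE. Qed.

Lemma hom_on1 : phi 1 = 1.
Proof.
have K1 := group_closed_set1.
by apply: (mulgI (phi 1)); rewrite -(hom_onM K1 K1) !mulg1.
Qed.

Lemma hom_onV x : K x -> phi x^-1 = (phi x)^-1.
Proof.
move=> Kx; apply: (mulgI (phi x)).
by rewrite -hom_onM ?mulgV ?hom_on1 //; exact: group_closed_setV.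
Qed.

Context {leL : relation L} {leM : relation M}.

Lemma sup_belowM f g v w :
  preordered_group leL -> preordered_group leM -> isotonic_on leL leM K phi ->
  has_value leL leM K phi f v -> has_value leL leM K phi g w ->
  sup_below leL leM K phi (f * g) (v * w).
Proof.
move=> leLG leMG phi_iso [_ supf inff] [_ supg infg].
have preL := preordered_group_preorder leLG.
split=> [_ [a [Ka afg] <-]|u ubu].
  (* Being an upper bound comes from the infima at [f] and [g]: [a <= f * g <= b * c]. *)
  apply: (le_infM leMG inff infg) => _ _ [b [Kb fb] <-] [c [Kc gc] <-].
  rewrite -hom_onM //; apply: (phi_le phi_iso) => //.
    exact: group_closed_setM.
  by transitivity (f * g) => //; exact: preordered_group_mul.
(* Leastness comes from the suprema, which are infima for the flipped order. *)
apply: (le_infM (preordered_group_flip leMG) supf supg).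
move=> _ _ [b [Kb bf] <-] [c [Kc cg] <-].
rewrite -hom_onM //; apply: ubu; exists (b * c) => //; split.
  exact: group_closed_setM.
exact: preordered_group_mul.
Qed.

End GroupValue.

Section GroupClosure.
Context {L M : groupType} {leL : relation L} {leM : relation M}.
Context {K : set L} {phi : L -> M}.
Hypotheses (leLG : preordered_group leL) (leMG : preordered_group leM).
Hypotheses (Kgrp : group_closed [in K]).
Hypotheses (phi_iso : isotonic_on leL leM K phi) (phi_hom : group_hom_on K phi).
Local Open Scope group_scope.

Lemma has_valueM f g v w :
  has_value leL leM K phi f v -> has_value leL leM K phi g w ->
  has_value leL leM K phi (f * g) (v * w).
Proof.
move=> fv gw; split; last 1 first.
(* The infimum of the product is its supremum for the flipped orders. *)
- apply: (@sup_belowM _ _ _ _ Kgrp phi_hom (flip leL) (flip leM)).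
  + exact: preordered_group_flip.
  + exact: preordered_group_flip.
  + by move=> x y Kx Ky; exact: phi_iso.
  + exact: has_value_flip.
  + exact: has_value_flip.
- have [[a [b [Ka Kb af fb]]] _ _] := fv.
  have [[c [e [Kc Ke cg ge]]] _ _] := gw.
  exists (a * c), (b * e).
  by split; try exact: (group_closed_setM Kgrp); exact: preordered_group_mul.
- exact: sup_belowM.
Qed.

(** Inversion is an isomorphism from the flipped orders to the original ones, so the value is
    flipped before being transported. *)
Lemma has_valueV f v :
  has_value leL leM K phi f v -> has_value leL leM K phi f^-1 v^-1.
Proof.
have KV := group_closed_setV Kgrp.
move=> fv; apply: (has_value_transport invgK invgK invgK invgK
  _ _ _ _ KV KV (hom_onV Kgrp phi_hom) (has_value_flip fv)) => x y.
- exact: (le_invg leLG).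
- exact: (le_invg leLG).
- exact: (le_invg leMG).
- exact: (le_invg leMG).
Qed.

Lemma has_value1 : has_value leL leM K phi 1 1.
Proof.
rewrite -[X in has_value _ _ _ _ _ X](hom_on1 Kgrp phi_hom).
apply: has_value_id => //; first exact: preordered_group_preorder.
exact: group_closed_set1.
Qed.

End GroupClosure.

(** * Values of sums and scalar multiples *)

Section VectorClosure.
Context {R : realType} {L M : lmodType R} {leL : relation L} {leM : relation M}.
Context {K : set L} {phi : L -> M}.
Hypotheses (leLV : preordered_vector_space leL).
Hypotheses (leMV : preordered_vector_space leM).
Hypotheses (Ksub : GRing.submod_closed [in K]).
Hypotheses (phi_iso : isotonic_on leL leM K phi) (phi_lin : linear_on K phi).
Local Open Scope ring_scope.

(** Through these multiplicative views the group results apply by conversion, with sums as products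
    and opposites as inverses. *)
Let L' : groupType := Algebra.to_multiplicative L.
Let M' : groupType := Algebra.to_multiplicative M.

Lemma submod_group_closed : @group_closed L' [in K].
Proof. by have [K0 KB] := GRing.submod_closedB Ksub. Qed.

Lemma linear_group_hom : @group_hom_on L' M' K phi.
Proof. by move=> x y Kx Ky; have := phi_lin 1 Kx Ky; rewrite !scale1r. Qed.

Lemma has_valueD f g v w :
  has_value leL leM K phi f v -> has_value leL leM K phi g w ->
  has_value leL leM K phi (f + g) (v + w).
Proof.
exact: (has_valueM leLV leMV submod_group_closed phi_iso linear_group_hom).
Qed.

Lemma has_valueN f v :
  has_value leL leM K phi f v -> has_value leL leM K phi (- f) (- v).
Proof.
exact: (has_valueV leLV leMV submod_group_closed linear_group_hom).
Qed.

Lemma has_value0 : has_value leL leM K phi 0 0.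
Proof.
exact: (has_value1 leLV submod_group_closed phi_iso linear_group_hom).
Qed.

Lemma submod_closed_setZ (k : R) x : K x -> K (k *: x).
Proof.
have [K0 Klin] := Ksub; move=> Kx; have := Klin k x 0.
by rewrite !inE addr0 in K0 *; apply.
Qed.

Lemma linear_onZ (k : R) x : K x -> phi (k *: x) = k *: phi x.
Proof.
move=> Kx; have [K0 _] := Ksub.
(* Linearity is used at [k *: x + 0], so [phi 0 = 0] is first drawn from additivity. *)
have phi0 : phi 0 = 0 := hom_on1 submod_group_closed linear_group_hom.
have := @phi_lin k x 0; rewrite phi0 !addr0; apply; first by rewrite inE.
exact: K0.
Qed.

(** Dilation by [k] is an order automorphism of both spaces, with inverse dilation by [k^-1], also
    positive. *)
Lemma has_valueZ_gt0 (k : R) f v : 0 < k ->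
  has_value leL leM K phi f v -> has_value leL leM K phi (k *: f) (k *: v).
Proof.
move=> k0; have kV0 : 0 < k^-1 by rewrite invr_gt0.
have scaleK (V : lmodType R) : cancel ( *:%R k : V -> V) ( *:%R k^-1).
  by apply: scalerK; rewrite gt_eqF.
have scaleVK (V : lmodType R) : cancel ( *:%R k^-1) ( *:%R k : V -> V).
  by apply: scalerKV; rewrite gt_eqF.
apply: (has_value_transport (scaleK L) (scaleVK L) (scaleK M) (scaleVK M) _ _ _ _
  (@submod_closed_setZ k) (@submod_closed_setZ k^-1) (@linear_onZ k)) => x y.
- exact: (preordered_vector_space_scale leLV).
- exact: (preordered_vector_space_scale leLV).
- exact: (preordered_vector_space_scale leMV).
- exact: (preordered_vector_space_scale leMV).
Qed.

Lemma has_valueZ (k : R) f v :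
  has_value leL leM K phi f v -> has_value leL leM K phi (k *: f) (k *: v).
Proof.
move=> fv; have [k0|k0|->] := ltrgt0P k.
- exact: has_valueZ_gt0.
(* A negative dilation is the positive one by [- k] followed by negation. *)
- rewrite -(opprK k) !(scaleNr (- k)).
  by apply/has_valueN/has_valueZ_gt0 => //; rewrite oppr_gt0.
- by rewrite !scale0r; exact: has_value0.
Qed.

End VectorClosure.

(** * From values back to the closure *)

Theorem theorem5 :
  (forall (L M : groupType) (leL : relation L) (leM : relation M)
     (K : set L) (phi : L -> M),
   preordered_group leL -> preordered_group leM -> order_complete leM ->
   group_closed [in K] ->
   isotonic_on leL leM K phi -> group_hom_on K phi ->
   [/\ group_closed [in ext_closure leL leM K phi],
       isotonic_on leL leM
         (ext_closure leL leM K phi) (upper_ext leL leM K phi) &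
       group_hom_on
         (ext_closure leL leM K phi) (upper_ext leL leM K phi)])
  /\
  (forall (R : realType) (L M : lmodType R)
     (leL : relation L) (leM : relation M) (K : set L) (phi : L -> M),
   preordered_vector_space leL -> preordered_vector_space leM ->
   order_complete leM ->
   GRing.submod_closed [in K] ->
   isotonic_on leL leM K phi -> linear_on K phi ->
   [/\ GRing.submod_closed [in ext_closure leL leM K phi],
       isotonic_on leL leM
         (ext_closure leL leM K phi) (upper_ext leL leM K phi) &
       linear_on
         (ext_closure leL leM K phi) (upper_ext leL leM K phi)]).
Proof.
split.
- move=> L M leL leM K phi leLG leMG complM Kgrp phi_iso phi_hom.
  have preL := preordered_group_preorder leLG.
  have preM := preordered_group_preorder leMG.
  have toV := has_value_upper_ext preL complM phi_iso.
  have ofV := has_value_closure preL preM complM phi_iso.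
  split; last 2 first.
  + exact: upper_ext_isotonic.
  + move=> f g; rewrite !inE => /toV fv /toV gw.
    exact: (ofV _ _ (has_valueM leLG leMG Kgrp phi_iso phi_hom fv gw)).2.
  split=> [|f g]; rewrite !inE.
    exact: (ofV _ _ (has_value1 leLG Kgrp phi_iso phi_hom)).1.
  (* [group_closed] asks for quotients, so the value at [g] is inverted before multiplying. *)
  move=> /toV fv /toV /(has_valueV leLG leMG Kgrp phi_hom) gw.
  exact: (ofV _ _ (has_valueM leLG leMG Kgrp phi_iso phi_hom fv gw)).1.
- move=> R L M leL leM K phi leLV leMV complM Ksub phi_iso phi_lin.
  have preL : PreOrder leL := preordered_group_preorder leLV.
  have preM : PreOrder leM := preordered_group_preorder leMV.
  have toV := has_value_upper_ext preL complM phi_iso.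
  have ofV := has_value_closure preL preM complM phi_iso.
  (* This one value yields both closedness of the closure and linearity of the extension. *)
  have lin k f g : f \in ext_closure leL leM K phi ->
      g \in ext_closure leL leM K phi ->
      has_value leL leM K phi (k *: f + g)%R
        (k *: upper_ext leL leM K phi f + upper_ext leL leM K phi g)%R.
    rewrite !inE => /toV fv /toV gw.
    by apply: has_valueD => //; exact: has_valueZ.
  split; last 2 first.
  + exact: upper_ext_isotonic.
  + by move=> k f g fK gK; exact: (ofV _ _ (lin k f g fK gK)).2.
  split=> [|k f g fK gK]; rewrite inE.
    exact: (ofV _ _ (has_value0 leLV Ksub phi_iso phi_lin)).1.
  exact: (ofV _ _ (lin k f g fK gK)).1.
Qed.
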